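(* If $X$ is a metric space of weight $\mathfrak{c}$, then $X$ admits a condensation onto the Hilbert cube $[0,1]^{\aleph_0}$.
   Context: A condensation is a bijective continuous mapping. The weight of a topological space is the least cardinality of a base of its topology; the weight of a metric space is the weight of the topology induced by its metric. $\mathfrak{c}=2^{\aleph_0}$ is the cardinality of the continuum. The Hilbert cube is the product of countably infinitely many copies of $[0,1]$ with the product topology. *)

(* Defs.v *)
From mathcomp Require Import all_boot all_order all_algebra.
From mathcomp Require Import all_classical all_reals all_analysis.
Import numFieldNormedType.Exports.

Set Implicit Arguments.
Unset Strict Implicit.
Unset Printing Implicit Defensive.

Local Open Scope classical_set_scope.
Local Open Scope ring_scope.
Local Open Scope card_scope.

(* There is no type of cardinals, only their comparison, so a cardinal is given
   by a set [K] of that cardinality: [|K|] is the least cardinality of a base. *)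
Definition has_weight (T : topologicalType) (U : Type) (K : set U) : Prop :=
  (exists2 B : set (set T), basis B & B #= K) /\
  (forall B : set (set T), basis B -> K #<= B).

Definition hilbert_cube (R : realType) : topologicalType :=
  {ptws nat -> `[(0 : R), 1]%classic}.

Definition condensation (S T : topologicalType) (f : S -> T) : Prop :=
  bijective f /\ continuous f.

(* Main.v *)
(* Since the continuum c has uncountable cofinality, X contains an r-separated
   set D of size c.  By Stone's theorem on sigma-discrete covers, countably many
   continuous functions separate the points of X; listing each of them
   infinitely often, with values in [0, 1/2], gives S : X -> [0, 1]^N such that
   every tail of S x determines x.  For y : D -> [0, 1]^N, let F x be S x with
   its n-th coordinate moved towards y d inside the ball of radius about r / n
   around each d in D.  Then F is continuous, F d = y d, and F x has the same
   tail as S x when x is not in D: F is injective off D whatever y is, and near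
   d it depends only on y d.  It remains to choose y as a bijection from D onto
   the complement of F (X \ D).  For this D is split into levels D_0, D_1, ...
   of size c, and D_k is mapped onto what the neighbourhoods of the points of
   D_(k - 1) have left uncovered among the points with their tails. *)
Require Import Defs.
From mathcomp Require Import all_boot all_order all_algebra.
From mathcomp Require Import all_classical all_reals all_analysis.
From mathcomp Require Import wochoice lra.
Import Order.TTheory GRing.Theory Num.Theory numFieldNormedType.Exports.

Set Implicit Arguments.
Unset Strict Implicit.
Unset Printing Implicit Defensive.

Local Open Scope classical_set_scope.
Local Open Scope ring_scope.
Local Open Scope card_scope.

(** * Codings by sets of natural numbers, and cardinality of the continuum *)

Definition code_seq (p : nat -> set nat) : set nat :=
  [set n | exists a b, n = pickle (a, b) /\ p a b].

Lemma code_seq_inj : injective code_seq.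
Proof.
move=> p q pq; apply/funext => a; apply/seteqP; split => b ab.
  have : code_seq q (pickle (a, b)) by rewrite -pq; exists a, b.
  by move=> [a' [b' [/(pcan_inj pickleK)[-> ->]]]].
have : code_seq p (pickle (a, b)) by rewrite pq; exists a, b.
by move=> [a' [b' [/(pcan_inj pickleK)[-> ->]]]].
Qed.

Definition code_pair (p : nat * set nat) : set nat :=
  code_seq (fun n => if n is 0%N then p.2 else [set p.1]).

Lemma code_pair_inj : injective code_pair.
Proof.
move=> [k A] [l B] /code_seq_inj/(congr1 (fun f => (f 0%N, f 1%N))) /= [-> kl].
by congr pair; have : [set l] k by rewrite -kl.
Qed.

(** The lower Dedekind cut of [x], with the rationals numbered by [pickle]. *)
Definition code_real (R : realType) (x : R) : set nat :=
  [set n | exists q : rat, n = pickle q /\ ratr q < x].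

Lemma code_real_inj (R : realType) : injective (@code_real R).
Proof.
suff H (x y : R) : x < y -> code_real x <> code_real y.
  move=> x y xy; apply/eqP; rewrite eq_le !leNgt.
  by apply/andP; split; apply/negP => /H; rewrite xy.
move=> xy cxy; have [q] := rat_in_itvoo xy; rewrite in_itv/= => /andP[xq qy].
have : code_real x (pickle q) by rewrite cxy; exists q.
move=> [q' [/(pcan_inj pickleK) <-]] qx.
by have := lt_trans xq qx; rewrite ltxx.
Qed.

Definition code_cube (R : realType) (q : hilbert_cube R) : set nat :=
  code_seq (fun n => code_real (set_val (q n))).

Lemma code_cube_inj (R : realType) : injective (@code_cube R).
Proof.
move=> p q /code_seq_inj pq; apply/funext => n; apply: val_inj.
exact/code_real_inj/(congr1 (fun f => f n) pq).
Qed.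

(* König's diagonal argument: otherwise choose p n outside the n-th projection of
   the sequences that [i] sends to [E n]; then [i] sends p to no [E n]. *)
Lemma continuum_cofinality (T : Type) (i : set nat -> T) (E : nat -> set T) :
  injective i -> (forall A, exists n, E n (i A)) ->
  exists n (u : set nat -> T), injective u /\ forall A, E n (u A).
Proof.
move=> iinj iE.
pose onto n := forall A, exists p, p n = A /\ E n (i (code_seq p)).
have [[n /choice[f fE]]|noto] := pselect (exists n, onto n).
  exists n, (fun A => i (code_seq (f A))); split=> [A B /iinj/code_seq_inj AB|A].
    by rewrite -(fE A).1 -(fE B).1 AB.
  exact: (fE A).2.
have /choice[p pP] n : exists A, forall p, p n = A -> ~ E n (i (code_seq p)).
  apply: contra_notP noto => nA; exists n => A.
  apply: contra_notP nA => nA; exists A => p pA Ep.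
  by apply: nA; exists p.
have [m Em] := iE (code_seq p).
by have := pP m p erefl Em.
Qed.

(** Cantor-Bernstein: [e] bounds the size of [A] from above, [u] from below. *)
Lemma set_enum_continuum (T : Type) (e : T -> set nat) (u : set nat -> T)
    (A : set T) :
  injective e -> injective u -> range u `<=` A ->
  exists2 b : set nat -> T, injective b & range b = A.
Proof.
move=> einj uinj uA.
have : A #= [set: set nat].
  apply: Cantor_Bernstein.
    by apply/pcard_injP; exists e => x y _ _ /einj.
  apply: (@card_le_trans _ _ _ (range u)); last exact: subset_card_le.
  suff /card_eqPle[] : [set: set nat] #= range u by [].
  by rewrite card_eq_sym; apply: inj_card_eq => x y _ _ /uinj.
move=> /card_set_bijP[f [_ finj fsurj]].
have /choice[b bP] t : exists q, A q /\ f q = t.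
  by have [q Aq qt] := fsurj t I; exists q.
exists b => [s t st|]; first by rewrite -(bP s).2 -(bP t).2 st.
apply/seteqP; split=> [_ [t _ <-]|q Aq]; first exact: (bP t).1.
exists (f q) => //; apply: finj; rewrite ?inE//; last exact: (bP (f q)).2.
exact: (bP (f q)).1.
Qed.

(* [G x q] stands for the point to which x is sent when the centre nearest to x
   is sent to q. What remains uncovered by the neighbourhoods of the centres of
   level k - 1 is taken as the set of targets of the centres of level k; the
   values of [m] make every such set of targets have size continuum. *)
Lemma levelled_bijection (X Q : Type) (d : nat * set nat -> X)
    (c : X -> nat * set nat) (G : X -> Q -> Q) (m : nat * set nat -> Q)
    (e : Q -> set nat) :
  cancel d c -> (forall p q, G (d p) q = q) ->
  (forall x x' q q', ~ range d x -> ~ range d x' -> G x q = G x' q' -> x = x') ->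
  injective m -> (forall p x q, ~ range d x -> G x q <> m p) ->
  injective e ->
  exists y : nat * set nat -> Q, bijective (fun x => G x (y (c x))).
Proof.
move=> dK Gd Ginj minj Gm einj.
(* [Ginj] and [Gm] make the level well defined; points outside both families get level 0 by
   default. *)
have [lev [levG levm]] : exists lev : Q -> nat,
    (forall x q, ~ range d x -> lev (G x q) = (c x).1.+1) /\
    (forall p, lev (m p) = p.1).
  suff /choice[lev levP] q : exists k : nat,
      (forall x q', ~ range d x -> G x q' = q -> k = (c x).1.+1) /\
      (forall p, m p = q -> k = p.1).
    exists lev; split=> [x q dx|p]; first exact: (levP _).1 dx erefl.
    exact: (levP _).2.
  have [[x [q' [dx xq]]]|nx] := pselect (exists x q', ~ range d x /\ G x q' = q).
    exists (c x).1.+1; split=> [x' q'' dx'|p mp].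
      by rewrite -xq => /(Ginj _ _ _ _ dx' dx) ->.
    by have := Gm p x q' dx; rewrite xq mp.
  have [[p mp]|np] := pselect (exists p, m p = q).
    exists p.1; split=> [x q' dx xq|p']; first by case: nx; exists x, q'.
    by rewrite -mp => /minj ->.
  exists 0%N; split=> [x q' dx xq|p mp]; first by case: nx; exists x, q'.
  by case: np; exists p.
pose hit (u : set nat -> Q) q := exists x, ~ range d x /\ G x (u (c x).2) = q.
(* Here [lev q = k] forces [(c x).1.+1 = k] for every [x] that hits [q], so only the centres of
   level [k - 1] matter. *)
pose target k u := [set q | lev q = k /\ ~ hit u q].
have /choice[enum enumP] (ku : nat * (set nat -> Q)) :
    exists b : set nat -> Q, injective b /\ range b = target ku.1 ku.2.
  have [||b binj bE] := @set_enum_continuum Q e (fun A => m (ku.1, A))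
    (target ku.1 ku.2) einj.
  - by move=> A B /minj[].
  - move=> _ [A _ <-]; split; first by rewrite levm.
    by move=> [x [dx]]; exact: Gm.
  by exists b.
(* At level 0 the map into [m] only stands in for a previous level: points off the centres have
   images of positive level. *)
pose Y := fix Y k := if k is k'.+1 then enum (k, Y k')
                     else enum (0%N, fun A => m (0%N, A)).
pose prev k := if k is k'.+1 then Y k' else fun A => m (0%N, A).
have YE k : injective (Y k) /\ range (Y k) = target k (prev k).
  by case: k => [|k]; exact: (enumP (_, _)).
have levY k A : lev (Y k A) = k.
  by have [_ E] := YE k; have : range (Y k) (Y k A) by []; rewrite E => -[].
have hitY k A : ~ hit (prev k) (Y k A).
  by have [_ E] := YE k; have : range (Y k) (Y k A) by []; rewrite E => -[].
exists (fun p => Y p.1 p.2); set F := fun x => _.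
have Fd p : F (d p) = Y p.1 p.2 by rewrite /F dK Gd.
have Fdn p x : ~ range d x -> F (d p) <> F x.
  move=> dx; rewrite Fd => pE; apply: (hitY p.1 p.2); rewrite pE; exists x.
  by split=> //; rewrite -(levY p.1 p.2) pE /F levG.
have Finj : injective F.
  move=> x x'; have [[p _ <-]|dx] := pselect (range d x);
    have [[p' _ <-]|dx'] := pselect (range d x').
  - rewrite !Fd; case: p p' => [k A] [k' A'] /= E; congr d.
    have kk' : k = k' by rewrite -(levY k A) E levY.
    by rewrite -kk' in E *; rewrite ((YE k).1 _ _ E).
  - by move/Fdn => /(_ dx').
  - by move/esym/Fdn => /(_ dx).
  - exact: Ginj.
have /choice[g gP] q : exists x, F x = q.
  (* A point of level k is either hit from level k - 1 or enumerated by [Y k]. *)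
  have [[x [dx xq]]|nh] := pselect (hit (prev (lev q)) q).
    by exists x; rewrite -xq /F -xq levG.
  have : range (Y (lev q)) q by rewrite (YE _).2.
  by move=> [A _ Aq]; exists (d (lev q, A)); rewrite Fd.
by exists g => // x; apply: Finj; rewrite gP.
Qed.

(** * Suprema of Lipschitz cones *)

Section tent.
Context {R : realType} {X : metricType R}.
Implicit Types (K : R) (w : X -> R) (x z : X).

Definition peak K z x : R := Num.max 0 (1 - K * mdist x z).

Lemma peak_ge0 K z x : 0 <= peak K z x.
Proof. by rewrite /peak le_max lexx. Qed.

Lemma peak_le1 K z x : 0 <= K -> peak K z x <= 1.
Proof. by move=> K0; rewrite /peak ge_max ler01 gerBl mulr_ge0// mdist_ge0. Qed.

Lemma peakxx K z : peak K z z = 1.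
Proof. by rewrite /peak mdistxx mulr0 subr0; apply/max_idPr/ler01. Qed.

Lemma peak_eq0 K z x : 1 <= K * mdist x z -> peak K z x = 0.
Proof. by move=> h; apply/max_idPl; rewrite subr_le0. Qed.

Lemma peak_lipschitz K z x x' :
  0 <= K -> peak K z x <= peak K z x' + K * mdist x x'.
Proof.
move=> K0; rewrite {1}/peak ge_max addr_ge0 ?peak_ge0 ?mulr_ge0 ?mdist_ge0//=.
have : 1 - K * mdist x' z <= peak K z x' by rewrite /peak le_max lexx orbT.
suff : K * mdist x' z <= K * mdist x z + K * mdist x x' by lra.
by rewrite -mulrDr ler_wpM2l// addrC (metric_sym x) metric_triangle.
Qed.

(** The supremum is [K]-Lipschitz for any weights in [0, 1], hence continuous even when [w] is
    not. *)
Definition tent K w x : R := sup [set w z * peak K z x | z in [set: X]].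

Section bounded.
Variables (K : R) (w : X -> R).
Hypotheses (K0 : 0 <= K) (w01 : forall z, 0 <= w z <= 1).

Let w0 z : 0 <= w z. Proof. by case/andP: (w01 z). Qed.
Let w1 z : w z <= 1. Proof. by case/andP: (w01 z). Qed.

Lemma tent_ge z x : w z * peak K z x <= tent K w x.
Proof.
apply: sup_upper_bound; last by exists z.
split; first by exists (w x * peak K x x), x.
by exists 1 => _ [z' _ <-]; rewrite mulr_ile1// ?peak_ge0// peak_le1.
Qed.

Lemma tent_le x a : (forall z, w z * peak K z x <= a) -> tent K w x <= a.
Proof.
move=> wa; apply: ge_sup => [|_ [z _ <-]]; last exact: wa.
by exists (w x * peak K x x), x.
Qed.

Lemma tent01 x : 0 <= tent K w x <= 1.
Proof.
apply/andP; split; last first.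
  by apply: tent_le => z; rewrite mulr_ile1// ?peak_ge0// peak_le1.
by apply: le_trans (tent_ge x x); rewrite mulr_ge0// peak_ge0.
Qed.

Lemma tent_lipschitz x x' : tent K w x <= tent K w x' + K * mdist x x'.
Proof.
apply: tent_le => z; apply: le_trans (_ : w z * peak K z x' + K * mdist x x' <= _).
  have Km : 0 <= K * mdist x x' by rewrite mulr_ge0// mdist_ge0.
  have := ler_wpM2l (w0 z) (peak_lipschitz z x x' K0).
  by have := ler_wpM2r Km (w1 z); rewrite mulrDr mul1r; lra.
by rewrite lerD2r tent_ge.
Qed.

Lemma tent_continuous : continuous (tent K w : X -> R).
Proof.
move=> x; apply/cvgrPdist_lt => e e0.
have K1 : 0 < K + 1 by rewrite ltr_wpDl.
have : nbhs x (ball x (e / (K + 1))) by apply: nbhsx_ballx; rewrite divr_gt0.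
rewrite ballEmdist; apply: filterS => x' /=.
rewrite ltr_pdivlMr// mulrDr mulr1 => xx'.
have := mdist_ge0 x x'.
have := tent_lipschitz x x'; have := tent_lipschitz x' x.
rewrite (metric_sym x' x) => h1 h2 h3.
rewrite ltr_norml; apply/andP; split; lra.
Qed.

(** Meant for centres so far apart that at most one cone is nonzero at [x]. *)
Lemma tent_eq z x :
  (forall z', z' <> z -> w z' * peak K z' x = 0) -> tent K w x = w z * peak K z x.
Proof.
move=> wz; apply/eqP; rewrite eq_le tent_ge andbT; apply: tent_le => z'.
have [->//|/eqP/wz ->] := eqVneq z' z.
by rewrite mulr_ge0// peak_ge0.
Qed.

End bounded.

Lemma indic01 (W : set X) z : 0 <= (\1_W z : R) <= 1.
Proof. by rewrite indicE; case: (_ \in _); rewrite ?lexx ler01. Qed.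

(** For nonempty [W] this tent is max(0, 1 - dist(x, W)), so the value 1 detects the closure of
    [W]. *)
Lemma tent_indic_eq1 (W : set X) x :
  tent 1 (\1_W) x = 1 <-> forall e : R, 0 < e -> exists2 z, W z & mdist x z < e.
Proof.
split=> [t1 e e0|W0].
  apply: contrapT => nW.
  have : tent 1 (\1_W) x <= Num.max 0 (1 - e).
    apply: tent_le => z; rewrite indicE; have [/set_mem Wz|_] := boolP (z \in W).
      rewrite mul1r /peak mul1r ge_max le_max lexx/= le_max lerD2l lerN2.
      by rewrite (leNgt e) orbC; case: ltP => // xz; case: nW; exists z.
    by rewrite mul0r le_max lexx.
  by rewrite t1 le_max ler10/=; lra.
apply/eqP; rewrite eq_le (andP (tent01 ler01 (indic01 W) x)).2/=.
apply/ler_addgt0Pl => e /W0[z Wz xz].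
have := tent_ge ler01 (indic01 W) z x; rewrite indicE mem_set// mul1r => h.
have : 1 - 1 * mdist x z <= peak 1 z x by rewrite /peak le_max lexx orbT.
by lra.
Qed.

End tent.

(** * Metric spaces of weight continuum *)

Section weight_continuum.
Context {R : realType} {X : metricType R}.

Definition separated (r : R) (D : set X) :=
  forall a b, D a -> D b -> a <> b -> r <= mdist a b.

Lemma mball_open (x : X) (r : R) : open (ball x r).
Proof.
rewrite openE => y; rewrite ballEmdist/= => xy.
have : nbhs y (ball y (r - mdist x y)) by apply: nbhsx_ballx; rewrite subr_gt0.
apply: filterS => z; rewrite !ballEmdist/= => yz.
by have := metric_triangle x y z; lra.
Qed.

(** By Zorn's lemma: a point at distance at least [r] from a maximal separated set could be added to
    it. *)
Lemma exists_separated_net (r : R) : 0 < r ->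
  exists D : set X, separated r D /\ forall x, exists2 d, D d & mdist x d < r.
Proof.
move=> r0; have [F FP Ftot|D [Dsep Dmax]] := @Zorn_bigcup X (separated r).
  move=> a b [A FA Aa] [B FB Bb]; have [AB|BA] := Ftot _ _ FA FB.
    by apply: FP FB _ _ _ Bb; exact: AB.
  by apply: FP FA _ _ Aa _; exact: BA.
exists D; split=> // x; apply: contrapT => nx.
have xD d : D d -> r <= mdist x d.
  by move=> Dd; rewrite leNgt; apply/negP => xd; apply: nx; exists d.
apply: (Dmax (x |` D)).
  split=> [d Dd|Dx]; first by right.
  by have := xD x (Dx x (or_introl erefl)); rewrite mdistxx leNgt r0.
move=> a b [->|Da] [->|Db] // ab; [exact: xD| |exact: Dsep].
by rewrite metric_sym; exact: xD.
Qed.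

Lemma exists_null_seq :
  exists v : nat -> R, (forall n, 0 < v n) /\ forall e, 0 < e -> exists n, v n < e.
Proof.
exists (fun n => n.+1%:R^-1); split=> [n|e e0]; first by rewrite invr_gt0.
have [n _ nE] := near_infty_natSinv_lt (PosNum e0).
by exists n; apply: nE => /=.
Qed.

(** Balls around ever finer nets form a base, so there are at least continuum many of them. By
    [continuum_cofinality] a single net already contributes that many, and their centres are
    separated. *)
Lemma separated_continuum : has_weight X [set: set nat] ->
  exists2 r : R, 0 < r & exists s : set nat -> X,
    forall A B, A <> B -> r <= mdist (s A) (s B).
Proof.
move=> [_ weight]; have [v [v0 vlt]] := exists_null_seq.
have /choice[D DP] n := exists_separated_net (v0 n).
pose E n := [set ball d (2 * v n) | d in D n].
have /weight/pcard_leP[i] : basis (\bigcup_n E n).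
  split=> [_ [n _ [d _ <-]]|x U]; first exact: mball_open.
  rewrite -nbhs_ballE => -[e /= e0 xU].
  have [n ne] : exists n, v n < e / 4.
    by apply: vlt; rewrite divr_gt0.
  have [d Dd xd] := (DP n).2 x; exists (ball d (2 * v n)).
    split; first by exists n => //; exists d.
    by rewrite ballEmdist/= metric_sym; have := v0 n; lra.
  move=> y; rewrite ballEmdist/= => dy; apply: xU; rewrite ballEmdist/=.
  by have := metric_triangle x d y; have := v0 n; lra.
have [||n [u [uinj uE]]] := @continuum_cofinality _ i E.
- by move=> A B; apply: inj; rewrite inE.
- by move=> A; have [n _ En] := 'funS_i (I : [set: set nat] A); exists n.
have /choice[s sP] A : exists d, D n d /\ ball d (2 * v n) = u A.
  by have [d Dd dA] := uE A; exists d.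
exists (v n) => //; exists s => A B AB.
apply: (DP n).1 (sP A).1 (sP B).1 _ => sAB; apply/AB/uinj.
by rewrite -(sP A).2 -(sP B).2 sAB.
Qed.

(** A point is determined by a sequence of base elements shrinking to it, and the continuum has only
    continuum many sequences. *)
Lemma card_continuum : has_weight X [set: set nat] ->
  exists e : X -> set nat, injective e.
Proof.
move=> [[B [_ Bbasis] /card_eqPle[/pcard_injP[b binj] _]] _].
have [v [v0 vlt]] := exists_null_seq.
have /choice[U UP] (xn : X * nat) :
    exists U, [/\ B U, U xn.1 & U `<=` ball xn.1 (v xn.2)].
  have [|V [BV Vx] Vb] := Bbasis xn.1 (ball xn.1 (v xn.2)).
    exact: nbhsx_ballx.
  by exists V.
exists (fun x => code_seq (fun n => b (U (x, n)))) => x y /code_seq_inj xy.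
apply/eqP; rewrite -[_ == _]negbK -mdist_gt0; apply/negP => /vlt[n].
suff : mdist x y < v n by move=> /ltW; rewrite leNgt => /negP.
have [BUx _ Ux] := UP (x, n); have [BUy Uyy _] := UP (y, n).
have Uxy : U (x, n) = U (y, n).
  apply: binj; rewrite ?inE//.
  exact: (congr1 (fun f => f n) xy).
have /= := Ux y; rewrite ballEmdist/= Uxy; exact.
Qed.

(* Stone's construction: the first element, in a well-order of [X], of the
   [r]-neighbourhood of [x]. *)
Lemma exists_first_center (r : R) : 0 < r ->
  exists c : X -> X, (forall x, mdist x (c x) < r) /\
    forall x y (e : R), mdist x (c x) + e <= r -> mdist y (c y) + e <= r ->
      mdist x y < e -> c x = c y.
Proof.
move=> r0; have [W Wwo] := well_ordering_principle X.
have /choice[c cP] x : exists a, mdist x a < r /\ forall b, mdist x b < r -> W a b.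
  have [|a [[xa aW] _]] := Wwo [pred a | mdist x a < r].
    by exists x; rewrite inE mdistxx.
  by exists a; split=> // b xb; apply: aW.
exists c; split=> [x|x y e xr yr xy]; first exact: (cP x).1.
have Wanti : antisymmetric W.
  by move=> a b; apply: (@wo_chain_antisymmetric _ W predT) => //; exact: withinW.
(* Each of the two centres lies in the [r]-neighbourhood of the other point, so minimality applies
   both ways. *)
apply: Wanti; apply/andP; split; [apply: (cP x).2|apply: (cP y).2].
  by have := metric_triangle x y (c y); lra.
by have := metric_triangle y x (c x); rewrite (metric_sym y x); lra.
Qed.

(** Once a margin is kept, the sets of points with a common first centre form a discrete family. The
    bits of the centres' codes select countably many unions of its members, and tents detect the
    closures of these unions. *)
Lemma separating_sequence : has_weight X [set: set nat] ->
  exists h : nat -> X -> R, [/\ forall n, continuous (h n),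
    forall n x, 0 <= h n x <= 1 & forall x y, (forall n, h n x = h n y) -> x = y].
Proof.
move=> /card_continuum[e einj]; have [v [v0 vlt]] := exists_null_seq.
have /choice[c cP] (k : nat) := exists_first_center (v0 k).
(* [bits] always contains 0, so that a point of the closure of the union of
   the sets [W k n j] over all j is already in the closure of [W k n 0]. *)
pose bits a : set nat := [set j | if j is j'.+1 then e a j' else True].
(* The margin [v n] is the one in [exists_first_center]: points of [T k n] closer than [v n] share
   their centre. *)
pose T k n := [set x | mdist x (c k x) + v n <= v k].
pose W k n j := [set x | T k n x /\ bits (c k x) j].
pose h i := if unpickle i is Some (k, n, j) then tent 1 (\1_(W k n j)) else cst 0.
exists h; split=> [i|i x|x y hxy].
- rewrite /h; case: unpickle => [[[k n] j]|]; last exact: cst_continuous.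
  exact: tent_continuous ler01 (indic01 _).
- rewrite /h; case: unpickle => [[[k n] j]|]; last by rewrite lexx ler01.
  exact: tent01 ler01 (indic01 _) _.
have {h} hxy k n j : tent 1 (\1_(W k n j)) x = tent 1 (\1_(W k n j)) y.
  by have := hxy (pickle (k, n, j)); rewrite /h pickleK.
apply/eqP; rewrite -[_ == _]negbK -mdist_gt0; apply/negP => xy.
(* Once [x] and some [z] near [y] share a centre, three steps shorter than [mdist x y / 4] join [x]
   to [y], a contradiction. *)
have [k kxy] : exists k, v k < mdist x y / 4.
  by apply: vlt; rewrite divr_gt0.
have [near_c cc] := cP k.
have [n xn] : exists n, v n < v k - mdist x (c k x).
  by apply: vlt; rewrite subr_gt0.
have n0 := v0 n.
have Tx : T k n x by rewrite /T/=; lra.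
have inW j z : T k n z -> bits (c k z) j -> tent 1 (\1_(W k n j)) z = 1.
  by move=> Tz zj; apply/tent_indic_eq1 => a a0; exists z; rewrite ?mdistxx.
have yW j : bits (c k x) j -> tent 1 (\1_(W k n j)) y = 1.
  by move=> xj; rewrite -hxy; exact: inW.
have /tent_indic_eq1 /(_ (Num.min (v n / 2) (mdist x y / 4)))[] := yW 0%N I.
  by rewrite lt_min !divr_gt0.
move=> z [Tz _]; rewrite lt_min => /andP[yzn yzd].
suff cxz : c k x = c k z.
  have := near_c x; have := near_c z; rewrite cxz => zc xc.
  have := metric_triangle x (c k z) y; have := metric_triangle (c k z) z y.
  by rewrite (metric_sym (c k z) z) (metric_sym z y); lra.
apply: einj; suff b : bits (c k x) = bits (c k z).
  by apply/funext => j; exact: (congr1 (fun f => f j.+1) b).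
(* A bit [j] of [c k x] puts [y] in the closure of [W k n j], whose points near [y] share the centre
   of [z]. *)
apply/seteqP; split=> j => [/yW/tent_indic_eq1|zj].
  move=> /(_ (v n / 2))[|z' [Tz' z'j] yz']; first by rewrite divr_gt0.
  rewrite (cc z z' (v n))//.
  by have := metric_triangle z y z'; rewrite (metric_sym z y); lra.
(* Conversely, a bit [j] of [c k z] puts [y], hence [x], in the closure of [W k n j], whose points
   near [x] share the centre of [x]. *)
have : tent 1 (\1_(W k n j)) y = 1.
  apply/tent_indic_eq1 => a a0.
  have /tent_indic_eq1 /(_ (Num.min (v n / 2) a))[] := yW 0%N I.
    by rewrite lt_min a0 divr_gt0.
  move=> z' [Tz' _]; rewrite lt_min => /andP[yz' z'a]; exists z' => //.
  split=> //; rewrite -(cc z z' (v n))//.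
  by have := metric_triangle z y z'; rewrite (metric_sym z y); lra.
rewrite -hxy => /tent_indic_eq1 /(_ (v n) n0)[z' [Tz' z'j] xz'].
by rewrite (cc x z' (v n)).
Qed.

End weight_continuum.

(** * Maps into the Hilbert cube and the condensation *)

Lemma hilbert_cube_continuous (R : realType) (T : topologicalType)
    (f : T -> hilbert_cube R) :
  (forall n, continuous (fun x => set_val (f x n) : R)) -> continuous f.
Proof.
move=> fc x; apply/cvg_sup => n.
apply: (continuous_comp_initial (w := fun q : hilbert_cube R => q n)
  (f := f)).
exact/(continuous_comp_initial (w := set_val))/fc.
Qed.

Lemma unit_itv_point (R : realType) (t : R) :
  0 <= t <= 1 -> exists q : `[(0 : R), 1]%classic, set_val q = t.
Proof.
move=> t01; have t01' : `[(0 : R), 1]%classic t by rewrite /= in_itv.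
by exists (SigSub (mem_set t01')).
Qed.

Lemma unit_itv_val (R : realType) (q : `[(0 : R), 1]%classic) :
  0 <= set_val q <= 1.
Proof. by have := set_valP q; rewrite /= in_itv. Qed.

(* The exponent of 2 in n takes every value infinitely often. *)
Lemma recurrent_separating_sequence (R : realType) (X : Type)
    (h : nat -> X -> R) (x y : X) (N : nat) :
  (forall x y, (forall n, h n x = h n y) -> x = y) ->
  (forall n, (N <= n)%N -> h (logn 2 n) x = h (logn 2 n) y) -> x = y.
Proof.
move=> hinj xy; apply: hinj => n.
(* This index has 2-exponent [n] and is at least [N]. *)
have := xy (2 ^ n * 3 ^ N)%N; rewrite lognM ?expn_gt0// !lognX logn_prime//.
rewrite [logn 2 3]logn_prime// muln0 muln1 addn0; apply.
by apply: leq_trans (ltnW (ltn_expl N (isT : 1 < 3)%N)) (leq_pmull _ _); rewrite expn_gt0.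
Qed.

(* [set nat] has cardinality 2^aleph_0 *)
Theorem theorem3p4 (R : realType) (X : metricType R) :
  has_weight X [set: set nat]%classic ->
  exists f : X -> hilbert_cube R, condensation f.
Proof.
move=> wX.
have [r r0 [s sP]] := separated_continuum wX.
have [h [hc h01 hinj]] := separating_sequence wX.
(* Indexing by pairs sorts the centres into countably many levels of size continuum. *)
pose d p := s (code_pair p).
have dP p q : p <> q -> r <= mdist (d p) (d q).
  by move=> pq; apply: sP => /code_pair_inj.
(* If no centre is within [r / 2] of [x], the value of [c x] is arbitrary; all [mu n x] below then
   vanish. *)
have /choice[c cP] x : exists p, forall q, mdist x (d q) < r / 2 -> q = p.
  have [[p xp]|np] := pselect (exists p, mdist x (d p) < r / 2).
    exists p => q xq; apply: contrapT => /dP.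
    by have := metric_triangle (d q) x (d p); rewrite (metric_sym (d q) x); lra.
  by exists (0%N, set0) => q xq; case: np; exists q.
have dK : cancel d c by move=> p; apply/esym/cP; rewrite mdistxx divr_gt0.
(* The cones of slope [K n] have radius r / (2 (n + 1)): those at distinct centres are disjoint, and
   they shrink as [n] grows. *)
pose K n := n.+1%:R * (2 / r).
have K0 n : 0 <= K n by rewrite mulr_ge0// divr_ge0// ltW.
have far x n p : p <> c x -> 1 <= K n * mdist x (d p).
  move=> px; apply: le_trans (_ : 2 / r * mdist x (d p) <= _).
    rewrite mulrAC ler_pdivlMr// mul1r.
    have : r / 2 <= mdist x (d p) by rewrite leNgt; apply/negP => /cP.
    by lra.
  by rewrite /K -[leRHS]mulrA ler_peMl ?ler1n// mulr_ge0 ?mdist_ge0// divr_ge0// ltW.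
pose S n x := h (logn 2 n) x / 2.
have S01 n x : 0 <= S n x <= 2^-1.
  by have /andP[h0 h1] := h01 (logn 2 n) x; apply/andP; rewrite /S; split; lra.
pose mu n x := peak (K n) (d (c x)) x.
have mu01 n x : 0 <= mu n x <= 1 by rewrite peak_ge0 peak_le1.
have /choice[G GP] (x : X) : exists g : hilbert_cube R -> hilbert_cube R,
    forall q n, set_val (g q n) = S n x * (1 - mu n x) + mu n x * set_val (q n).
  suff /choice[g gP] (q : hilbert_cube R) : exists g : hilbert_cube R,
      forall n, set_val (g n) = S n x * (1 - mu n x) + mu n x * set_val (q n).
    by exists g.
  suff /choice[g gP] n : exists t : `[(0 : R), 1]%classic,
      set_val t = S n x * (1 - mu n x) + mu n x * set_val (q n) by exists g.
  apply: unit_itv_point; have := S01 n x; have := mu01 n x.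
  by have := unit_itv_val (q n); nra.
have Gtail x : ~ range d x ->
    exists N, forall q n, (N <= n)%N -> set_val (G x q n) = S n x.
  move=> dx; have x0 : 0 < mdist x (d (c x)).
    by rewrite mdist_gt0; apply/eqP => xE; apply: dx; exists (c x).
  (* From this index on, the cone at [d (c x)] is too narrow to reach [x]. *)
  exists (Num.bound (r / 2 / mdist x (d (c x)))) => q n Nn.
  rewrite GP /mu peak_eq0 ?mul0r ?addr0 ?subr0 ?mulr1//.
  have : r / 2 / mdist x (d (c x)) <= n.+1%:R.
    apply: le_trans (ltW (archi_boundP _)) _.
      by rewrite divr_ge0 ?mdist_ge0// divr_ge0// ltW.
    by rewrite ler_nat leqW.
  rewrite ler_pdivrMr// ler_pdivrMr// => h1.
  by rewrite /K mulrA mulrAC ler_pdivlMr// mul1r mulrAC.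
have Gd p q : G (d p) q = q.
  apply/funext => n; apply/val_inj; rewrite [LHS]GP /mu dK peakxx.
  by rewrite subrr mulr0 add0r mul1r.
have Ginj x x' q q' : ~ range d x -> ~ range d x' -> G x q = G x' q' -> x = x'.
  move=> /Gtail[N NP] /Gtail[N' NP'] xx'.
  apply: (@recurrent_separating_sequence _ _ h _ _ (maxn N N') hinj) => n.
  rewrite geq_max => /andP[Nn N'n]; have := NP q n Nn.
  by rewrite xx' NP'// /S; lra.
(* The values 1 and 3/4 spell out [code_pair p], and both exceed 1/2, the bound on [S], so [m p]
   shares no coordinate with any [S x]. *)
have /choice[m mP] (p : nat * set nat) : exists m : hilbert_cube R,
    forall n, set_val (m n) = if n \in code_pair p then 1 else 3 / 4 :> R.
  suff /choice[m mP] n : exists t : `[(0 : R), 1]%classic,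
      set_val t = if n \in code_pair p then 1 else 3 / 4 :> R by exists m.
  by apply: unit_itv_point; case: ifP; lra.
have minj : injective m.
  move=> p p' pp'; apply: code_pair_inj; apply/funext => n; apply/propext.
  have := mP p n; rewrite pp' mP.
  case: ifPn => [/set_mem Hp'|/negP Hp']; case: ifPn => [/set_mem Hp|/negP Hp] //.
  - by lra.
  - by lra.
  - by move=> _; split=> /mem_set.
have Gm p x q : ~ range d x -> G x q <> m p.
  move=> /Gtail[N NP] xp; have := NP q N (leqnn N); rewrite xp mP.
  by have /andP[_] := S01 N x; case: ifP; lra.
have [y ybij] := levelled_bijection dK Gd Ginj minj Gm (@code_cube_inj R).
exists (fun x => G x (y (c x))); split=> //.
apply: hilbert_cube_continuous => n.
(* The centre [d (c x)] may jump with [x]. As only its cone can be nonzero at [x], both [mu n] and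
   its product with the coordinate of [y] are tents, hence continuous. *)
pose w z : R := if z \in range d then set_val (y (c z) n) else 0.
have w01 z : 0 <= w z <= 1.
  by rewrite /w; case: ifP; rewrite ?lexx ?ler01// => _; exact: unit_itv_val.
have off (u : X -> R) x z : (forall z, z \notin range d -> u z = 0) ->
    z <> d (c x) -> u z * peak (K n) z x = 0.
  move=> u0 zx; have [/set_mem[p _ pz]|/u0 ->] := boolP (z \in range d).
    rewrite -pz peak_eq0 ?mulr0//; apply: far => px.
    by apply: zx; rewrite -pz px.
  by rewrite mul0r.
have dr p : d p \in range d by apply: mem_set; exists p.
have muE : mu n = tent (K n) (\1_(range d)).
  apply/funext => x; rewrite (tent_eq (K0 n) (indic01 _) (z := d (c x))).
    by rewrite indicE dr mul1r.
  by move=> z; apply: off => z' /negbTE dz'; rewrite indicE dz'.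
have wE : (fun x => mu n x * set_val (y (c x) n)) = tent (K n) w.
  apply/funext => x; rewrite (tent_eq (K0 n) w01 (z := d (c x))).
    by rewrite /w dr dK mulrC.
  by move=> z; apply: off => z' /negbTE dz'; rewrite /w dz'.
have -> : (fun x => set_val (G x (y (c x)) n)) =
    (fun x => S n x * (1 - mu n x) + tent (K n) w x).
  by apply/funext => x; rewrite GP -wE.
move=> x; apply: cvgD; last exact: tent_continuous.
apply: cvgM; first by apply: cvgMl; exact: hc.
apply: cvgB; first exact: cvg_cst.
by rewrite muE; exact: tent_continuous (indic01 _) _.
Qed.
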